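(* There are stationary ordered generalized Bratteli diagrams $B$ with a unique infinite minimal path $x_{min}$ and a unique infinite maximal path $x_{max}$ realizing each of the following, where $\varphi_B:X_B\to X_B$ is the Vershik map (so that $\varphi_B(x_{max})=x_{min}$): (i) both the Vershik map $\varphi_B$ and its inverse $\varphi_B^{-1}$ are not continuous; (ii) the Vershik map $\varphi_B$ is continuous but the inverse $\varphi_B^{-1}$ is discontinuous; (iii) both the Vershik map $\varphi_B$ and its inverse $\varphi_B^{-1}$ are continuous. (That is, for each of (i), (ii), (iii) there exists such a diagram with the stated property.)
   Context: A generalized Bratteli diagram is a graded graph $B=(V,E)$ with $V=\bigsqcup_{i\ge0}V_i$, $E=\bigsqcup_{i\ge0}E_i$, where every level $V_i$ is countably infinite, $E_i$ is a countable set of edges from $V_i$ to $V_{i+1}$ with source and range maps $s,r$ satisfying $s(E_i)=V_i$, $r(E_i)=V_{i+1}$, and $|r^{-1}(v)|<\infty$ for every $v\in V\setminus V_0$. The path space $X_B$ is the set of infinite paths $x=(x_i)_{i\ge0}$, $x_i\in E_i$, $r(x_i)=s(x_{i+1})$, with the topology generated by the cylinder sets $[\overline e]=\{x: x_0=e_0,\dots,x_n=e_n\}$. Standing assumptions on diagrams: $X_B$ has no isolated points, all classes of the tail equivalence relation ($x\sim y$ iff $x_i=y_i$ for all large $i$) are infinite, and $B$ is connected as an undirected graph. An ordered diagram carries a linear order on each finite set $r^{-1}(v)$, $v\in V\setminus V_0$. A stationary ordered diagram is one in which all levels are identified with one countable set, the incidence matrix $F_n$ (whose $(v,w)$ entry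 is the number of edges from $w\in V_n$ to $v\in V_{n+1}$) does not depend on $n$, and the order is the same on every $E_n$ (under an identification of the edge sets $E_n$ compatible with $s$ and $r$). A (finite or infinite) path is maximal (minimal) if each of its edges $e_i$ is maximal (minimal) in $r^{-1}(r(e_i))$; $X_{max}$, $X_{min}$ are the sets of infinite maximal, minimal paths. The map $\varphi_B:X_B\setminus X_{max}\to X_B\setminus X_{min}$ sends $x=(x_0,x_1,\dots)$ to $(g_0,\dots,g_{m-1},g_m,x_{m+1},\dots)$, where $m$ is the least index with $x_m$ not maximal, $g_m$ is the successor of $x_m$ in $r^{-1}(r(x_m))$ and $(g_0,\dots,g_{m-1})$ is the minimal path from $V_0$ to $s(g_m)$. A Vershik map is an extension of this map to a Borel bijection $X_B\to X_B$; if $|X_{max}|=|X_{min}|=1$ it is unique. *)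

(* Defs.v *)
From Stdlib Require Import Relation_Operators.
From HB Require Import structures.
From mathcomp Require Import all_boot finmap.
From mathcomp Require Import boolp classical_sets functions cardinality.
From mathcomp Require Import topology_structure measurable_structure.

Set Implicit Arguments.
Unset Strict Implicit.
Unset Printing Implicit Defensive.

Local Open Scope classical_set_scope.

(* Vertices and edges of each level are [countType]s, so they are countable by
   construction; edges of level [i] go from level [i] to level [i.+1]. *)
Record bratteli := Bratteli {
  vertex : nat -> countType;
  edge : nat -> countType;
  src : forall i, edge i -> vertex i;
  rng : forall i, edge i -> vertex i.+1;
  vertex_infinite : forall i, infinite_set [set: vertex i];
  src_surj : forall i (v : vertex i), exists e : edge i, src e = v;
  rng_surj : forall i (v : vertex i.+1), exists e : edge i, rng e = v;
  rng_finite : forall i (v : vertex i.+1), finite_set [set e : edge i | rng e = v]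
}.
Arguments src {b i} _.
Arguments rng {b i} _.

Definition incidence (B : bratteli) (i : nat)
    (v : vertex B i.+1) (w : vertex B i) : nat :=
  #|` fset_set [set e : edge B i | src e = w /\ rng e = v] |.

Record path_space (B : bratteli) := Path {
  path_edge :> forall i, edge B i;
  path_rng_src : forall i, rng (path_edge i) = src (path_edge i.+1)
}.

(* A finite path (e_0, ..., e_n) is the restriction to the indices [i <= n] of a
   sequence of edges satisfying [is_finite_path n]. *)
Definition is_finite_path (B : bratteli) (n : nat) (e : forall i, edge B i) :=
  forall i, i < n -> rng (e i) = src (e i.+1).

Definition cylinder (B : bratteli) (n : nat) (e : forall i, edge B i) :
  set (path_space B) :=
  [set x : path_space B | forall i, i <= n -> x i = e i].

Definition cylinders (B : bratteli) : set (set (path_space B)) :=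
  [set A | exists n (e : forall i, edge B i),
     is_finite_path n e /\ A = cylinder n e].

HB.instance Definition _ (B : bratteli) := gen_eqMixin (path_space B).
HB.instance Definition _ (B : bratteli) := gen_choiceMixin (path_space B).
HB.instance Definition _ (B : bratteli) :=
  @isSubBaseTopological.Build (path_space B) _ (@cylinders B) id.

Definition tail_equiv (B : bratteli) (x y : path_space B) :=
  exists N, forall i, N <= i -> x i = y i.

Definition adjacent (B : bratteli) (u v : {i : nat & vertex B i}) :=
  exists i (e : edge B i), u = existT _ i (src e) /\ v = existT _ i.+1 (rng e).

Definition standing_assumptions (B : bratteli) :=
  [/\ isolated [set: path_space B] = set0,
      forall x : path_space B, infinite_set [set y | tail_equiv x y] &
      forall u v, clos_refl_sym_trans _ (@adjacent B) u v].

(* [ele] relates only edges with the same range. *)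
Record ordered_bratteli := OrderedBratteli {
  diagram :> bratteli;
  ele : forall i, rel (edge diagram i);
  ele_rng : forall i (e f : edge diagram i), ele e f -> rng e = rng f;
  ele_refl : forall i, reflexive (@ele i);
  ele_anti : forall i, antisymmetric (@ele i);
  ele_trans : forall i, transitive (@ele i);
  ele_total : forall i (e f : edge diagram i),
    rng e = rng f -> ele e f || ele f e
}.
Arguments ele {o i} _ _.

(* [phi i] and [psi i] identify every level with the countable sets [V], [E];
   [F], [s], [r], [o] are the common incidence matrix, source, range and order. *)
Definition stationary (B : ordered_bratteli) :=
  exists (V E : countType) (F : V -> V -> nat) (s r : E -> V) (o : rel E)
         (phi : forall i, vertex B i -> V) (psi : forall i, edge B i -> E),
    [/\ forall i, bijective (phi i),
        forall i, bijective (psi i),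
        forall i (v : vertex B i.+1) (w : vertex B i),
          incidence v w = F (phi i.+1 v) (phi i w),
        forall i (e : edge B i),
          s (psi i e) = phi i (src e) /\ r (psi i e) = phi i.+1 (rng e) &
        forall i (e f : edge B i), ele e f = o (psi i e) (psi i f)].

Section Vershik.
Variable B : ordered_bratteli.
Implicit Types x y : path_space B.

Definition max_edge i (e : edge B i) := forall f, rng f = rng e -> ele f e.
Definition min_edge i (e : edge B i) := forall f, rng f = rng e -> ele e f.

Definition X_max : set (path_space B) :=
  [set x : path_space B | forall i, max_edge (x i)].
Definition X_min : set (path_space B) :=
  [set x : path_space B | forall i, min_edge (x i)].

Definition is_succ i (e g : edge B i) :=
  [/\ ele e g, e <> g & forall h, ele e h -> e <> h -> ele g h].

(* The graph of the map from X_B \ X_max to X_B \ X_min. *)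
Definition vershik_step x y :=
  exists m, [/\ forall i, i < m -> max_edge (x i),
                ~ max_edge (x m),
                is_succ (x m) (y m),
                forall i, i < m -> min_edge (y i) &
                forall i, m < i -> y i = x i].

Definition borel : set (set (path_space B)) := <<s open >>.

Definition is_vershik_map (f : path_space B -> path_space B) :=
  [/\ bijective f,
      forall A, borel A -> borel (f @^-1` A) &
      forall x, ~ X_max x -> vershik_step x (f x)].

End Vershik.

(* [f] is the Vershik map and [g] its inverse. *)
Definition stationary_vershik_system (B : ordered_bratteli)
    (xmin xmax : path_space B) (f g : path_space B -> path_space B) :=
  [/\ standing_assumptions B, stationary B,
      X_min (B := B) = [set xmin] /\ X_max (B := B) = [set xmax],
      is_vershik_map f /\ f xmax = xmin &
      cancel f g /\ cancel g f].

(* Main.v *)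
From Stdlib Require Import Relation_Operators.
Require Import Defs.
From mathcomp Require Import all_boot finmap.
From mathcomp Require Import boolp classical_sets cardinality.
From mathcomp Require Import topology_structure measurable_structure.

Set Implicit Arguments.
Unset Strict Implicit.
Unset Printing Implicit Defensive.

Local Open Scope classical_set_scope.

(** Every vertex [v] receives five edges, ordered, with sources
    [lo v, v, rho, v, hi v], where [rho] is a fixed vertex and [lo], [hi] are
    maps fixing [rho]. The least edge into [v] comes from [lo v], so a minimal
    path read from right to left is an orbit of [lo]: an infinite one is a
    backward orbit of [lo]. If the constant orbit [rho] is the only infinite
    backward orbit ([rooted]), the minimal path is unique; likewise for [hi]
    and maximal paths. The three middle edges do the rest: the two loops at [v]
    and the edge from [rho] give perfectness, infinite tail classes and
    connectedness, whatever [lo] and [hi] are.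

    Away from the maximal path, the Vershik map changes only a prefix that is
    determined by finitely many coordinates, so it is continuous there, and
    being continuous off one point it is Borel. Near the maximal path, a path
    that is maximal up to a large level [m] is sent to the minimal path down
    from some vertex [w] of level [m], whose vertex at level [m - k] is
    [iter k lo w]. This is close to the minimal path for all [w] as soon as
    some fixed iterate of [lo] is constantly [rho]. Conversely, the edge from
    [v] follows the edge from [rho] in the order at [v], so every [v] occurs as
    such a [w] arbitrarily far along the maximal path; if no iterate of [lo] is
    constantly [rho], there are images of paths close to the maximal one that do not
    start at [rho]. So the Vershik map is continuous exactly when some iterate
    of [lo] is constantly [rho] ([vershik_continuousP]). Reversing all orders
    exchanges [lo] with [hi] and the Vershik map with its inverse, because the
    list of sources is symmetric; this gives the same criterion for the inverse
    with [hi] ([vershik_inv_continuousP]).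

    It remains to choose [lo] and [hi], independently of each other, among two
    rooted maps of [nat * nat]: [collapse], which is constant, and [climb],
    whose tree above the root has finite branches of unbounded length but no
    infinite one. *)

(** * The topology of the path space *)

Lemma path_ext (B : bratteli) (x y : path_space B) :
  (forall i, x i = y i) -> x = y.
Proof.
case: x y => [x xP] [y yP] /= xy.
have {}xy : x = y by exact: functional_extensionality_dep.
by case: _ / xy in yP *; congr Path; exact: Prop_irrelevance.
Qed.

Lemma cylinder_le (B : bratteli) m n (x y : path_space B) :
  m <= n -> cylinder n x y -> cylinder m x y.
Proof. by move=> mn xy i im; apply/xy/(leq_trans im). Qed.

Lemma nbhs_cylinder (B : bratteli) (x : path_space B) n :
  nbhs x (cylinder n x).
Proof.
apply: open_nbhs_nbhs; split; last by [].
exists [set cylinder n x]; last by rewrite bigcup_set1.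
move=> _ ->; apply: (@finI_from1 _ _ _ id).
by exists n, x; split=> // i _; exact: path_rng_src.
Qed.

(** Finite intersections of cylinders are the basic open sets; two cylinders
    that contain [x] are nested, so a single one is enough. *)
Lemma nbhsP_cylinder (B : bratteli) (x : path_space B)
    (A : set (path_space B)) :
  nbhs x A <-> exists n, cylinder n x `<=` A.
Proof.
split=> [|[n]]; last by move/filterS; apply; exact: nbhs_cylinder.
rewrite nbhsE => -[U [[D' D'I <-] [V D'V Vx] VA]].
have [F FD FV] := D'I _ D'V; have {}Vx : V x := Vx; rewrite -FV in Vx.
have /choice[h hP] : forall C, exists n, C \in F -> cylinder n x `<=` C.
  move=> C; have [CF|] := boolP (C \in F); last by exists 0.
  have /set_mem[n [e [_ CE]]] := FD _ CF; exists n => _.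
  have := Vx _ CF; rewrite CE => xe y xy i le_in.
  by rewrite xy // xe.
(* The longest of the finitely many prefixes serves for all of them. *)
exists (\max_(C <- F) h C) => y xy; apply: VA; exists V => //.
change (V y); rewrite -FV => C /= CF.
apply: (hP C CF); apply: cylinder_le xy.
exact: (leq_bigmax_seq C).
Qed.

Lemma continuous_at_cylinder (B C : bratteli)
    (f : path_space B -> path_space C) x :
  {for x, continuous f} <->
  forall n, exists m, cylinder m x `<=` f @^-1` cylinder n (f x).
Proof.
split=> [fx n|fx A /nbhsP_cylinder[n xA]].
  by apply/nbhsP_cylinder/fx/nbhs_cylinder.
have [m xm] := fx n; apply/nbhsP_cylinder; exists m.
by move=> y /xm /xA.
Qed.

Lemma closed_path1 (B : bratteli) (x : path_space B) : closed [set x].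
Proof.
rewrite -openC openE => y /= yx.
have [i xyi] : exists i, x i <> y i.
  apply: contra_notP yx => /forallNP xy; apply/esym/path_ext => i.
  exact: contrapT.
apply/nbhsP_cylinder; exists i => z yz zx; apply: xyi.
by rewrite -zx yz.
Qed.

(** The preimage of an open set is open up to the point [p], and points are
    closed. *)
Lemma borel_preimage_continuous_but1 (B : ordered_bratteli)
    (f : path_space B -> path_space B) p :
  (forall x, x <> p -> {for x, continuous f}) ->
  forall A, borel A -> borel (f @^-1` A).
Proof.
move=> fc A; rewrite -[f @^-1` A]setTI; move: A.
have s := smallest_sigma_algebra [set: path_space B] open.
apply: (smallest_sub (sigma_algebra_image f s)) => U oU.
rewrite /image_set_system /= setTI.
have op : <<s open >> [set p].
  rewrite -[[set p]]setCK -setTD; apply: sigma_algebraCD.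
  by apply: sub_sigma_algebra; rewrite openC; exact: closed_path1.
have oV : <<s open >> (f @^-1` U `\` [set p]).
  apply: sub_sigma_algebra; rewrite openE => x [Ux xp].
  apply: filterI; first by apply: (fc x xp); exact: open_nbhs_nbhs.
  by apply: open_nbhs_nbhs; split=> //; rewrite openC; exact: closed_path1.
have [Up|Up] := pselect (U (f p)).
  have -> : f @^-1` U = \bigcup_i bigcup2 [set p] (f @^-1` U `\` [set p]) i.
    by rewrite bigcup2E setD1K.
  apply: sigma_algebra_bigcup => -[|[|i]] //=.
  exact: (@sigma_algebra0 _ _ open).
have <- // : f @^-1` U `\` [set p] = f @^-1` U.
by apply/not_setD1.
Qed.

(** * The diagram with five edges at each vertex *)

Section Diagram.
Variables (V : countType) (rho : V).
Hypothesis V_infinite : infinite_set [set: V].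
Implicit Types (lo hi : V -> V) (v : V).

(** An edge is a pair of its range and its rank among the five edges with that
    range. Reversing the list exchanges [lo] and [hi], and [v] occurs
    next to [rho] on both sides. *)
Definition source lo hi (e : V * 'I_5) : V :=
  nth rho [:: lo e.1; e.1; rho; e.1; hi e.1] e.2.

(** The edge into [v] from [rho]. *)
Definition spoke v : V * 'I_5 := (v, Ordinal (isT : 2 < 5)).

(** The two edges from [v] to [v], of ranks 1 and 3. *)
Definition loop (b : bool) v : V * 'I_5 :=
  (v, if b then Ordinal (isT : 3 < 5) else Ordinal (isT : 1 < 5)).

Lemma source_surj lo hi v : exists e, source lo hi e = v.
Proof. by exists (loop false v). Qed.

Lemma range_surj v : exists e : V * 'I_5, e.1 = v.
Proof. by exists (spoke v). Qed.

Lemma range_finite v : finite_set [set e : V * 'I_5 | e.1 = v].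
Proof.
apply: (sub_finite_set _ (finite_image (fun k : 'I_5 => (v, k)) finite_finset)).
by move=> [w k] /= ->; exists k.
Qed.

Definition five_diagram lo hi : bratteli :=
  @Bratteli (fun=> V) (fun=> V * 'I_5)%type (fun=> source lo hi) (fun=> fst)
    (fun=> V_infinite) (fun=> @source_surj lo hi) (fun=> range_surj)
    (fun=> range_finite).

Definition edge_le (e f : V * 'I_5) := (e.1 == f.1) && (e.2 <= f.2).

Lemma edge_le_range e f : edge_le e f -> e.1 = f.1.
Proof. by case/andP => /eqP. Qed.

Lemma edge_le_refl : reflexive edge_le.
Proof. by move=> e; rewrite /edge_le eqxx leqnn. Qed.

Lemma edge_le_anti : antisymmetric edge_le.
Proof.
move=> [v k] [w l] /andP[/andP[/= /eqP -> kl] /andP[_ /= lk]].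
by congr (_, _); apply/val_inj/eqP; rewrite eqn_leq kl.
Qed.

Lemma edge_le_trans : transitive edge_le.
Proof.
move=> f e g /andP[/eqP ef lef] /andP[/eqP fg lfg].
by rewrite /edge_le ef fg eqxx (leq_trans lef).
Qed.

Lemma edge_le_total e f : e.1 = f.1 -> edge_le e f || edge_le f e.
Proof. by move=> ef; rewrite /edge_le ef eqxx leq_total. Qed.

Definition five_ordered lo hi : ordered_bratteli :=
  @OrderedBratteli (five_diagram lo hi) (fun=> edge_le) (fun=> edge_le_range)
    (fun=> edge_le_refl) (fun=> edge_le_anti) (fun=> edge_le_trans)
    (fun=> edge_le_total).

Local Notation D := five_ordered.

Definition mkpath lo hi (p : nat -> V * 'I_5)
    (pP : forall i, (p i).1 = source lo hi (p i.+1)) : path_space (D lo hi) :=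
  @Path (D lo hi) p pP.

Section Order.
Variables lo hi : V -> V.
Implicit Types x y : path_space (D lo hi).

Lemma min_edgeP i (e : edge (D lo hi) i) : min_edge e <-> e.2 = ord0.
Proof.
split=> [/(_ (e.1, ord0) erefl) /andP[_ /=]|e0 f /= fe].
  by rewrite leqn0 => /eqP e0; apply: val_inj.
by rewrite /ele /= /edge_le fe eqxx e0.
Qed.

Lemma max_edgeP i (e : edge (D lo hi) i) : max_edge e <-> e.2 = ord_max.
Proof.
split=> [/(_ (e.1, ord_max) erefl) /andP[_ /= e4]|e0 f /= fe].
  by apply: val_inj; apply/eqP; rewrite eqn_leq e4 -ltnS ltn_ord.
by rewrite /ele /= /edge_le fe eqxx e0 /= -ltnS ltn_ord.
Qed.

Lemma is_succP i (e g : edge (D lo hi) i) :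
  is_succ e g <-> g.1 = e.1 /\ g.2 = e.2.+1 :> nat.
Proof.
split.
  case=> /andP[/eqP eg leg] neg eg_min; split=> //.
  have ltn : e.2 < g.2.
    rewrite ltn_neqAle leg andbT; apply/eqP => /val_inj e2; apply: neg.
    by case: e g eg e2 {leg eg_min} => [? ?] [? ?] /= -> ->.
  have k5 : e.2.+1 < 5 by apply: leq_ltn_trans ltn (ltn_ord _).
  have /andP[_ /=] : edge_le g (e.1, Ordinal k5).
    apply: eg_min => /=; first by rewrite /ele /= /edge_le /= eqxx /=.
    by move/(congr1 (fun h : V * 'I_5 => val h.2)) => /= /n_Sn.
  by move=> le; apply/eqP; rewrite eqn_leq le.
case=> ge k; split.
- by rewrite /ele /= /edge_le ge eqxx k /=.
- by move=> eg; move: k; rewrite eg; exact: n_Sn.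
- move=> h /andP[/eqP eh leh] neh.
  rewrite /ele /= /edge_le ge eh eqxx k /= ltn_neqAle leh andbT.
  apply/eqP => /val_inj e2; apply: neh.
  by case: e h eh e2 {leh ge k} => [? ?] [? ?] /= -> ->.
Qed.

End Order.

Lemma source_flip lo hi (e : V * 'I_5) :
  source hi lo (e.1, rev_ord e.2) = source lo hi e.
Proof. by case: e => v [[|[|[|[|[]]]]] k] //. Qed.


(** * Reversing the orders *)

Definition flip lo hi (x : path_space (D lo hi)) : path_space (D hi lo).
Proof.
exists (fun i => ((x i).1, rev_ord (x i).2)) => i /=.
by rewrite source_flip; exact: (path_rng_src x i).
Defined.

Lemma flipK lo hi (x : path_space (D lo hi)) : flip (flip x) = x.
Proof. by apply: path_ext => i /=; rewrite rev_ordK; case: (x i). Qed.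

Lemma min_edge_flip lo hi (x : path_space (D lo hi)) i :
  min_edge (B := D hi lo) (flip x i) <-> max_edge (x i).
Proof.
rewrite min_edgeP max_edgeP /=; split=> [|->].
  by move/(congr1 (@rev_ord _)); rewrite rev_ordK => ->; apply: val_inj.
exact: val_inj.
Qed.

Lemma max_edge_flip lo hi (x : path_space (D lo hi)) i :
  max_edge (B := D hi lo) (flip x i) <-> min_edge (x i).
Proof. by rewrite -min_edge_flip flipK. Qed.

Definition step_at lo hi m (x y : path_space (D lo hi)) :=
  [/\ forall i, i < m -> max_edge (x i), ~ max_edge (x m),
      is_succ (x m) (y m), forall i, i < m -> min_edge (y i) &
      forall i, m < i -> y i = x i].

(** The graph of the Vershik map, including the exceptional pair. It is stated
    by [X_max] and [X_min] so that it makes sense before these are known to be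
    singletons, and is exchanged with its converse by [flip]. *)
Definition succ_path lo hi (x y : path_space (D lo hi)) :=
  vershik_step x y \/ X_max x /\ X_min y.

Lemma succ_path_flip lo hi (x y : path_space (D lo hi)) :
  succ_path x y -> succ_path (flip y) (flip x).
Proof.
case=> [[m [xmax xm xy ymin yx]]|[xmax ymin]]; last first.
  by right; split=> i; [apply/max_edge_flip|apply/min_edge_flip].
left; exists m; have /is_succP[xy1 xy2] := xy; split.
- by move=> i /ymin ?; apply/max_edge_flip.
- by move/max_edge_flip/min_edgeP => y0; move: xy2; rewrite y0.
- apply/is_succP; split; first exact: esym.
  have := ltn_ord (y m).2; rewrite xy2 ltnS => lt4.
  by rewrite /= xy2 (subSS _ 4) subSS subnSK.
- by move=> i /xmax ?; apply/min_edge_flip.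
- by move=> i /yx /= ->.
Qed.

(** * Minimal prefixes *)

Section Dynamics.
Variables lo hi : V -> V.
Implicit Types x y : path_space (D lo hi).

Lemma rng_src x i : (x i).1 = source lo hi (x i.+1).
Proof. exact: (path_rng_src x i). Qed.

Lemma src_min_edge x i : min_edge (x i) -> source lo hi (x i) = lo (x i).1.
Proof. by move/min_edgeP; rewrite /source => ->. Qed.

Lemma src_min_prefix x m k : k <= m -> (forall i, i < m -> min_edge (x i)) ->
  source lo hi (x (m - k)) = iter k lo (source lo hi (x m)).
Proof.
move=> + xmin; elim: k => [|k IHk] km; first by rewrite subn0.
rewrite src_min_edge; last by apply: xmin; rewrite ltn_subrL (leq_trans _ km).
by rewrite rng_src subnSK // IHk // ltnW.
Qed.

(** Minimal edges are determined by their ranges, hence a minimal prefix by the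
    edge that follows it. *)
Lemma eq_min_prefix x x' m : x m = x' m ->
  (forall i, i < m -> min_edge (x i)) -> (forall i, i < m -> min_edge (x' i)) ->
  forall i, i <= m -> x i = x' i.
Proof.
move=> xm xmin x'min i im; rewrite -(subKn im).
elim: (m - i) (leq_subr i m) => [|k IHk] km.
  by rewrite subn0.
have ltm : m - k.+1 < m by rewrite ltn_subrL (leq_trans _ km).
have /min_edgeP := xmin _ ltm; have /min_edgeP := x'min _ ltm.
have := rng_src x (m - k.+1); have := rng_src x' (m - k.+1).
rewrite subnSK // IHk 1?ltnW //.
case: (x _) (x' _) => [? ?] [? ?] /=.
by move=> -> -> -> ->.
Qed.

(** The last edge [e] leads back along the orbit of its source under [lo]. *)
Lemma min_graft x m (e : V * 'I_5) : e.1 = (x m).1 ->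
  exists y, [/\ forall i, i < m -> min_edge (y i), y m = e &
                forall i, m < i -> y i = x i].
Proof.
move=> em; pose w := source lo hi e.
pose p i : V * 'I_5 := if i < m then (iter (m - i.+1) lo w, ord0)
                       else if i == m then e else x i.
have pP i : (p i).1 = source lo hi (p i.+1).
  rewrite /p; case: (ltngtP i m) => [im|mi|->].
  - case: (ltngtP i.+1 m) => [im'|/leq_trans/(_ im)|im'] /=.
    + by rewrite /source /= -iterS subnSK.
    + by rewrite ltnn.
    + by rewrite im' subnn.
  - by rewrite ltnNge (leqW (ltnW mi)) /= gtn_eqF ?rng_src // leqW.
  - by rewrite ltnNge leqnSn gtn_eqF // em rng_src.
exists (mkpath pP); split=> [i im||i mi] /=; rewrite /p.
- by apply/min_edgeP => /=; rewrite im.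
- by rewrite ltnn eqxx.
- by rewrite ltnNge ltnW //= gtn_eqF.
Qed.

End Dynamics.

(** * The Vershik map *)

Section Successor.
Variables lo hi : V -> V.
Implicit Types x y : path_space (D lo hi).

Lemma step_index_uniq m m' x x' y y' : step_at m x y -> step_at m' x' y' ->
  (forall i, i <= m -> x i = x' i) -> m = m'.
Proof.
move=> [xmax xm _ _ _] [x'max x'm _ _ _] xx'.
case: (ltngtP m m') => // [mm'|m'm].
- by case: xm; rewrite xx'//; exact: x'max.
- by case: x'm; rewrite -xx' ?(ltnW m'm)//; exact: xmax.
Qed.

Lemma step_prefix m x x' y y' : step_at m x y -> step_at m x' y' ->
  x m = x' m -> forall i, i <= m -> y i = y' i.
Proof.
move=> [_ _ /is_succP xy ymin _] [_ _ /is_succP xy' y'min _] xx'.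
apply: eq_min_prefix => //; move: xy xy'; rewrite xx'.
case: (y m) (y' m) => [v k] [v' k'] /= [-> k1] [-> k1'].
by congr (_, _); apply: val_inj; rewrite /= k1 k1'.
Qed.

Lemma not_maxP x : ~ X_max x <->
  exists m, (forall i, i < m -> max_edge (x i)) /\ ~ max_edge (x m).
Proof.
split=> [/existsNP[n xn]|[m [_ xm]] /(_ m)//].
have ex_n : exists n, (x n).2 != ord_max.
  by exists n; apply/eqP => xn4; apply: xn; apply/max_edgeP.
case: (ex_minnP ex_n) => m xm m_min.
exists m; split=> [i im|/max_edgeP]; last exact/eqP.
apply/max_edgeP/eqP; apply: contraTT im => /m_min.
by rewrite -leqNgt.
Qed.

Lemma step_total x : ~ X_max x -> exists y, vershik_step x y.
Proof.
case/not_maxP => m [xmax xm].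
have k5 : (x m).2.+1 < 5.
  rewrite ltnS ltn_neqAle -ltnS ltn_ord andbT; apply/eqP => x4.
  by apply/xm/max_edgeP/val_inj.
have [|y [ymin ym yx]] := @min_graft lo hi x m ((x m).1, Ordinal k5); first by [].
by exists y, m; split=> //; apply/is_succP; rewrite ym.
Qed.

End Successor.

(** The sequence [u] is a backward orbit of [p]. *)
Definition rooted (p : V -> V) :=
  p rho = rho /\
  forall u : nat -> V, (forall i, p (u i.+1) = u i) -> forall i, u i = rho.

(** The vertices of a minimal path form a backward orbit of [lo]. *)
Lemma X_minP lo hi (x : path_space (D lo hi)) : rooted lo ->
  X_min x <-> forall i, x i = (rho, ord0).
Proof.
move=> [lo_rho lo_orb]; split=> [xmin|xE i]; last by apply/min_edgeP; rewrite xE.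
have xrho : forall i, source lo hi (x i) = rho.
  by apply: lo_orb => i; rewrite -rng_src -src_min_edge.
move=> i; have := rng_src x i; have /min_edgeP := xmin i; rewrite xrho.
by case: (x i) => [? ?] /= -> ->.
Qed.

Lemma xmin_subproof lo hi (lo_rooted : rooted lo) (i : nat) :
  (rho, ord0 : 'I_5).1 = source lo hi (rho, ord0).
Proof. by rewrite /source /= lo_rooted.1. Qed.

Definition xmin lo hi (lo_rooted : rooted lo) : path_space (D lo hi) :=
  mkpath (xmin_subproof hi lo_rooted).

Lemma X_min1 lo hi (lo_rooted : rooted lo) :
  X_min (B := D lo hi) = [set xmin hi lo_rooted].
Proof.
apply/seteqP; split=> [x /(X_minP _ lo_rooted) xE|_ ->]; last exact/X_minP.
exact: path_ext.
Qed.

Definition xmax lo hi (hi_rooted : rooted hi) : path_space (D lo hi) :=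
  flip (xmin lo hi_rooted).

Lemma X_max1 lo hi (hi_rooted : rooted hi) :
  X_max (B := D lo hi) = [set xmax lo hi_rooted].
Proof.
have key (x : path_space (D lo hi)) : X_max x <-> X_min (flip x).
  by split=> h i; apply/min_edge_flip/h.
apply/seteqP; split=> [x /key|_ ->]; last by apply/key; rewrite /xmax flipK X_min1.
rewrite X_min1 => xE; have -> : x = flip (flip x) by rewrite flipK.
by rewrite xE.
Qed.

Lemma succ_path_total lo hi (x : path_space (D lo hi)) :
  rooted lo -> exists y, succ_path x y.
Proof.
move=> lo_rooted; have [xmax|/step_total[y xy]] := pselect (X_max x).
  by exists (xmin hi lo_rooted); right; rewrite X_min1.
by exists y; left.
Qed.

Lemma succ_path_uniq lo hi (x y y' : path_space (D lo hi)) :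
  rooted lo -> succ_path x y -> succ_path x y' -> y = y'.
Proof.
move=> lo_rooted [[m xy]|[xmax ymin]] [[m' xy']|[xmax' ymin']].
- have mm' : m = m' by apply: step_index_uniq xy xy' _.
  rewrite -mm' in xy'; apply: path_ext => i; have [im|mi] := leqP i m.
    exact: (step_prefix xy xy').
  by have [_ _ _ _ ->] := xy => //; have [_ _ _ _ ->] := xy'.
- by have [_ []] := xy.
- by have [_ []] := xy'.
- by move: ymin ymin'; rewrite (X_min1 _ lo_rooted) => -> ->.
Qed.

Definition vershik lo hi (lo_rooted : rooted lo) (x : path_space (D lo hi)) :=
  sval (cid (succ_path_total x lo_rooted)).

Lemma vershikP lo hi (lo_rooted : rooted lo) (x y : path_space (D lo hi)) :
  vershik lo_rooted x = y <-> succ_path x y.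
Proof.
rewrite /vershik; case: cid => z /= xz; split=> [<- //|].
exact: succ_path_uniq.
Qed.

(** Successors for the reversed orders are predecessors. *)
Definition vershik_inv lo hi (hi_rooted : rooted hi)
    (x : path_space (D lo hi)) :=
  flip (vershik hi_rooted (flip x)).

Lemma vershikK lo hi (lo_rooted : rooted lo) (hi_rooted : rooted hi) :
  cancel (@vershik lo hi lo_rooted) (vershik_inv hi_rooted).
Proof.
move=> x; rewrite /vershik_inv -[RHS]flipK; congr flip.
by apply/vershikP/succ_path_flip/(vershikP lo_rooted).
Qed.

Lemma vershik_invK lo hi (lo_rooted : rooted lo) (hi_rooted : rooted hi) :
  cancel (vershik_inv hi_rooted) (@vershik lo hi lo_rooted).
Proof.
move=> x; rewrite /vershik_inv.
apply: (can_inj (@flipK lo hi)).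
exact: (vershikK hi_rooted lo_rooted (flip x)).
Qed.

(** A path close to [x] leaves the maximal edges at the same index as [x], with
    the same edge, and its image therefore has the same new prefix. *)
Lemma vershik_continuous_at lo hi (lo_rooted : rooted lo)
    (x : path_space (D lo hi)) :
  ~ X_max x -> {for x, continuous (vershik (hi := hi) lo_rooted)}.
Proof.
move=> xnmax; apply/continuous_at_cylinder => n.
have /(vershikP lo_rooted) := erefl (vershik lo_rooted x).
move: (vershik _ x) => y [[m xy]|[]//]; exists (maxn m n) => x' xx' /=.
have xx'm i : i <= m -> x i = x' i.
  by move=> im; rewrite xx' // leq_max im.
have /(vershikP lo_rooted) := erefl (vershik lo_rooted x').
move: (vershik _ x') => y' [[m' xy']|[/(_ m)]]; last first.
  by rewrite -xx'm //; have [] := xy.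
have mm' := step_index_uniq xy xy' xx'm; rewrite -mm' in xy'.
move=> i i_n; have [im|mi] := leqP i m.
  by rewrite (step_prefix xy xy') // xx'm.
have [_ _ _ _ ->] := xy => //; have [_ _ _ _ ->] := xy' => //.
by rewrite xx' // leq_max i_n orbT.
Qed.

Definition uniformly_rooted (p : V -> V) :=
  exists k, forall v, iter k p v = rho.

(** If [lo] collapses in [k] steps, then a path that is maximal up to level
    [n + k + 1] has an image that is minimal up to level [n]. Otherwise, given
    [v] far from the root, follow the maximal path and then the edge [spoke v]:
    the next edge is a loop at [v], and going back from [v] along [lo] does not
    reach [rho]. *)
Lemma vershik_continuousP lo hi
    (lo_rooted : rooted lo) (hi_rooted : rooted hi) :
  continuous (@vershik lo hi lo_rooted) <-> uniformly_rooted lo.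
Proof.
set f := vershik lo_rooted.
have fmax : f (xmax lo hi_rooted) = xmin hi lo_rooted.
  by apply/vershikP; right; rewrite (X_max1 _ hi_rooted) (X_min1 _ lo_rooted).
split=> [/(_ (xmax lo hi_rooted))/continuous_at_cylinder/(_ 0)[n fn]|[k k_rho] x].
  (* Here [n] is such that maximality up to level [n] forces the image to begin
     with the first edge of the minimal path. *)
  exists n.+1 => v.
  pose p i := if i <= n then (rho, ord_max) else if i == n.+1 then spoke v
              else loop false v.
  have pP i : (p i).1 = source lo hi (p i.+1).
    rewrite /p; case: (ltngtP i n) => [lt|ni|->].
    - by rewrite /source /= hi_rooted.1.
    - by rewrite eqSS (gtn_eqF ni); case: ifP.
    - by rewrite eqxx.
  have pE : p n.+1 = spoke v by rewrite /p ltnn eqxx.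
  pose x := mkpath pP.
  have /(vershikP lo_rooted) := erefl (f x).
  have y0 : f x 0 = (rho, ord0).
    rewrite [LHS](fn x _ 0 isT) ?fmax // => i i_n /=.
    by rewrite /p i_n; congr (_, _); apply: val_inj.
  move: (f x) y0 => y y0.
  have xmax0 i : i < n.+1 -> max_edge (x i).
    by move=> im; apply/max_edgeP => /=; rewrite /p -ltnS im.
  have xm : ~ max_edge (x n.+1) by move/max_edgeP => /=; rewrite pE.
  case=> [[m xy]|[/(_ n.+1)//]].
  have mE : m = n.+1.
    have [xmaxm xmm _ _ _] := xy; case: (ltngtP m n.+1) => // [|] lt.
    - by case: xmm; exact: xmax0.
    - by case: xm; exact: xmaxm.
  rewrite mE in xy; have [_ _ /is_succP[y1 y2] ymin _] := xy.
  have <- : source lo hi (y n.+1) = v by rewrite /source y2 y1 /= pE.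
  by rewrite -(src_min_prefix (leqnn _) ymin) subnn y0 /source /= lo_rooted.1.
have [xmax|xnmax] := pselect (X_max x); last exact: vershik_continuous_at.
rewrite (X_max1 lo hi_rooted) in xmax; rewrite xmax.
apply/continuous_at_cylinder => n; rewrite fmax.
exists (n + k).+1 => y ymax.
have /(vershikP lo_rooted) := erefl (f y).
rewrite /= -/f; move: (f y) => z [[m yz]|[_]]; last first.
  by rewrite (X_min1 _ lo_rooted) => ->.
have mn : (n + k).+1 < m.
  have [_ ym _ _ _] := yz; rewrite ltnNge; apply/negP => le; apply: ym.
  by apply/max_edgeP; rewrite (ymax _ le); exact: val_inj.
have [_ _ _ zmin _] := yz.
have zrho i : i <= n.+1 -> source lo hi (z i) = rho.
  move=> i_n; have im : i + k <= m.
    by apply: leq_trans (ltnW mn); rewrite -addSn leq_add2r.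
  rewrite -[i](subKn (leq_trans (leq_addr k i) im)).
  rewrite (src_min_prefix (leq_subr _ _) zmin).
  have km : k <= m - i by rewrite leq_subRL ?(leq_trans (leq_addr k i)).
  by rewrite -(subnKC km) iterD k_rho.
move=> i i_n; have /min_edgeP z0 : min_edge (z i).
  apply: zmin; apply: leq_ltn_trans mn; apply/leqW/(leq_trans i_n)/leq_addr.
have := rng_src z i; rewrite zrho //.
by case: (z i) z0 => [? ?] /= -> ->.
Qed.


(** * Continuity of the inverse *)

Lemma flip_continuous lo hi : continuous (@flip lo hi).
Proof.
move=> x; apply/continuous_at_cylinder => n; exists n => y xy i i_n /=.
by rewrite xy.
Qed.

(** Conjugation by the homeomorphism [flip] reduces this to the Vershik map of
    the reversed diagram. *)
Lemma vershik_inv_continuousP lo hi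
    (lo_rooted : rooted lo) (hi_rooted : rooted hi) :
  continuous (@vershik_inv lo hi hi_rooted) <-> uniformly_rooted hi.
Proof.
rewrite -(vershik_continuousP hi_rooted lo_rooted).
split=> cont x; last first.
  apply: (@continuous_comp _ _ _ (vershik hi_rooted \o @flip lo hi)).
    by apply: continuous_comp; [exact: flip_continuous|exact: cont].
  exact: flip_continuous.
have -> : vershik hi_rooted = @flip _ _ \o vershik_inv hi_rooted \o @flip hi lo.
  by apply/funext => y; rewrite /= /vershik_inv !flipK.
apply: continuous_comp; first exact: flip_continuous.
by apply: continuous_comp; [exact: cont|exact: flip_continuous].
Qed.

(** * The standing assumptions *)

(** After any prefix there is a choice between two loops. *)
Lemma no_isolated_path lo hi : isolated [set: path_space (D lo hi)] = set0.
Proof.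
rewrite -subset0 => x [_ [U /nbhsP_cylinder[n xU]]]; rewrite setIT => UE.
pose b := x n.+1 == loop false (x n).1.
pose p i := if i <= n then x i else loop b (x n).1.
have pP i : (p i).1 = source lo hi (p i.+1).
  rewrite /p; case: (ltngtP i n) => [lt|ni|->]; first by rewrite rng_src.
    by case: (b).
  by case: (b).
have /xU : cylinder n x (mkpath pP) by move=> i i_n; rewrite /= /p i_n.
rewrite UE => /= /(congr1 (fun y : path_space (D lo hi) => y n.+1)) /=.
rewrite /p ltnn /b; case: eqP => [xloop|xloop] xE; last exact/xloop/esym.
by rewrite xloop in xE.
Qed.

(** For each [n], some path differs from [x] at level [n] and agrees with it
    beyond; the last level of disagreement tells these paths apart. *)
Lemma infinite_tail_class lo hi (x : path_space (D lo hi)) :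
  infinite_set [set y | tail_equiv x y].
Proof.
pose e n := if x n == spoke (x n).1 then loop false (x n).1 else spoke (x n).1.
have ex n : (e n).1 = (x n).1 by rewrite /e; case: ifP.
have ne n : e n <> x n.
  by rewrite /e; case: eqP => [->|/nesym].
have /choice[z zP] : forall n, exists y : path_space (D lo hi),
    y n <> x n /\ forall i, n < i -> y i = x i.
  by move=> n; have [y [_ yn yx]] := min_graft (ex n); exists y; rewrite yn.
have z_inj : injective z.
  move=> m n zmn; case: (ltngtP m n) => // lt.
    by have [_ /(_ n lt)] := zP m; rewrite zmn; have [] := zP n.
  by have [_ /(_ m lt)] := zP n; rewrite -zmn; have [] := zP m.
apply/infiniteP; apply: (@card_le_trans _ _ _ (z @` setT)).
  have := inj_card_eq (in2W z_inj : {in [set: nat] &, injective z}).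
  by rewrite card_eq_le => /andP[].
apply: subset_card_le => _ [n _ <-]; exists n.+1 => i ni.
by have [_ ->] := zP n.
Qed.

Lemma five_connected lo hi a b :
  clos_refl_sym_trans _ (@adjacent (D lo hi)) a b.
Proof.
pose vx i w : {i : nat & vertex (D lo hi) i} := existT _ i w.
have edgeP i (e : V * 'I_5) : clos_refl_sym_trans _ (@adjacent (D lo hi))
    (vx i (source lo hi e)) (vx i.+1 e.1).
  by apply: rst_step; exists i, e.
have to_root i w : clos_refl_sym_trans _ (@adjacent (D lo hi))
    (vx i w) (vx 0 rho).
  elim: i w => [|i IHi] w.
    apply: rst_trans (edgeP 0 (loop false w)) _.
    exact: rst_sym (edgeP 0 (spoke w)).
  exact: rst_trans (rst_sym _ _ _ _ (edgeP i (spoke w))) (IHi _).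
case: a b => [i w] [j w'].
exact: rst_trans (to_root i w) (rst_sym _ _ _ _ (to_root j w')).
Qed.

Lemma five_stationary lo hi : stationary (D lo hi).
Proof.
exists V, (V * 'I_5)%type, (@incidence (D lo hi) 0), (source lo hi), fst.
exists edge_le.
by exists (fun=> id), (fun=> id); split=> // i; exists id.
Qed.

Lemma five_system lo hi (lo_rooted : rooted lo) (hi_rooted : rooted hi) :
  stationary_vershik_system (xmin hi lo_rooted) (xmax lo hi_rooted)
    (vershik lo_rooted) (vershik_inv hi_rooted).
Proof.
have fK := vershikK lo_rooted hi_rooted.
have gK := vershik_invK lo_rooted hi_rooted.
split; last by [].
- split; [exact: no_isolated_path| |exact: five_connected].
  exact: infinite_tail_class.
- exact: five_stationary.
- by split; [exact: X_min1|exact: X_max1].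
- split; last by apply/vershikP; right; rewrite X_min1 X_max1.
  split; first by exists (vershik_inv hi_rooted).
  + apply: (@borel_preimage_continuous_but1 _ _ (xmax lo hi_rooted)) => x xm.
    by apply: vershik_continuous_at; rewrite (X_max1 lo hi_rooted).
  + move=> x xm; have /(vershikP lo_rooted) := erefl (vershik lo_rooted x).
    by case=> // -[].
Qed.

End Diagram.

(** * Two rooted maps, and the three systems *)

Definition collapse (v : nat * nat) : nat * nat := (0, 0).

(** Climbing the branch that joins [(n, k)] to [(n + k, 0)], and from its end to
    the root [(0, 0)]. *)
Definition climb (v : nat * nat) : nat * nat :=
  if v.2 is k.+1 then (v.1.+1, k) else (0, 0).

Lemma collapse_rooted : rooted (0, 0) collapse.
Proof. by split=> // u uE i; rewrite -uE. Qed.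

Lemma collapse_uniform : uniformly_rooted (0, 0) collapse.
Proof. by exists 1. Qed.

(** Along a backward orbit that avoids the root, the first coordinate
    decreases. *)
Lemma climb_rooted : rooted (0, 0) climb.
Proof.
split=> // u uE i; apply/eqP; apply/negPn/negP => ui.
have key k : u (i + k) != (0, 0) /\ (u (i + k)).1 + k <= (u i).1.
  elim: k => [|k [nz le]]; first by rewrite addn0 addn0.
  rewrite addnS; move: nz le; rewrite -(uE (i + k)) /climb.
  case: (u _) => [n [|l]] //= _ le.
  by rewrite xpair_eqE andbF -addSnnS.
have [_ /(leq_trans (leq_addl _ _))] := key (u i).1.+1.
by rewrite ltnn.
Qed.

Lemma climb_not_uniform : ~ uniformly_rooted (0, 0) climb.
Proof.
have climb_iter j n : iter j climb (n, j) = (n + j, 0).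
  by elim: j n => [|j IHj] n; rewrite ?addn0 // iterSr /= IHj addnS.
by case=> k /(_ (1, k)); rewrite climb_iter.
Qed.

(** Taking [collapse] for [lo] makes the map continuous and [climb] makes it
    discontinuous; [hi] decides in the same way about the inverse. *)
Theorem theorem4p7 :
  (exists (B : ordered_bratteli) (xmin xmax : path_space B)
          (f g : path_space B -> path_space B),
     [/\ stationary_vershik_system xmin xmax f g,
         ~ continuous f & ~ continuous g]) /\
  (exists (B : ordered_bratteli) (xmin xmax : path_space B)
          (f g : path_space B -> path_space B),
     [/\ stationary_vershik_system xmin xmax f g,
         continuous f & ~ continuous g]) /\
  (exists (B : ordered_bratteli) (xmin xmax : path_space B)
          (f g : path_space B -> path_space B),
     [/\ stationary_vershik_system xmin xmax f g,
         continuous f & continuous g]).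
Proof.
have realize lo hi
    (lo_rooted : rooted (0, 0) lo) (hi_rooted : rooted (0, 0) hi) :
    exists (B : ordered_bratteli) (xmin xmax : path_space B)
           (f g : path_space B -> path_space B),
      [/\ stationary_vershik_system xmin xmax f g,
          continuous f <-> uniformly_rooted (0, 0) lo &
          continuous g <-> uniformly_rooted (0, 0) hi].
  exists (five_ordered (0, 0) infinite_prod_nat lo hi).
  exists (xmin _ hi lo_rooted), (xmax _ lo hi_rooted).
  exists (vershik lo_rooted), (vershik_inv hi_rooted).
  split; first exact: five_system.
    exact: vershik_continuousP.
  exact: vershik_inv_continuousP.
split; last split.
- have [B [xmin [xmax [f [g [sys fc gc]]]]]] :=
    realize _ _ climb_rooted climb_rooted.
  exists B, xmin, xmax, f, g; split=> //; [move/fc|move/gc];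
    exact: climb_not_uniform.
- have [B [xmin [xmax [f [g [sys fc gc]]]]]] :=
    realize _ _ collapse_rooted climb_rooted.
  exists B, xmin, xmax, f, g; split=> //; first exact/fc/collapse_uniform.
  by move/gc; exact: climb_not_uniform.
- have [B [xmin [xmax [f [g [sys fc gc]]]]]] :=
    realize _ _ collapse_rooted collapse_rooted.
  exists B, xmin, xmax, f, g; split=> //; [apply/fc|apply/gc];
    exact: collapse_uniform.
Qed.
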